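(* Let $n\ge 1$, let $C=[c_{k,l}]$ be an $n\times n$ matrix whose entries (on and above the diagonal) are powers of $t$, let $d_1,\ldots,d_n$ be powers of $t$, and let $D$ be the $n\times n$ matrix all of whose rows equal $[d_1,\ldots,d_n]$. Then $$Q_{n}(t,q;\, C;\, d_{1},\ldots,d_{n}) = \sum_{i=1}^{n} q^{i-1}\, c_{i,i}^{n-i}\, c_{i,i+1}^{n-i-1}\cdots c_{i,n-1}^{1}\cdot Q_{n-1}\bigl(t,q;\; R_{2}(C,D,i);\; d_{1},\ldots,d_{i-1},\, t d_{i} d_{i+1},\, d_{i+2},\ldots,d_{n}\bigr),$$ where for $i=n$ the list in the last argument is to be read as $d_1,\ldots,d_{n-1}$, and the product of entries of $C$ is $\prod_{j=i}^{n-1}c_{i,j}^{\,n-j}$ (empty product $=1$ when $i=n$).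
   Context: $\mathcal{S}_n$ is the set of permutations $\pi=\pi_1\ldots\pi_n$ of $\{1,\ldots,n\}$. $\mathrm{inv}(\pi)$ is the number of pairs $1\le a<b\le n$ with $\pi_a>\pi_b$. $N_{1324}(\pi)$ is the number of occurrences of the pattern $1324$ in $\pi$, i.e. the number of index quadruples $1\le a<b<c<d\le n$ with $\pi_a<\pi_c<\pi_b<\pi_d$. Let $t$, $q$, $x_{i,j}$ ($1\le i\le j\le n$) and $y_{i,j}$ ($1\le j\le i\le n$) be commuting variables. The weight of $\pi\in\mathcal{S}_n$ is $$\mathrm{weight}(\pi) := t^{N_{1324}(\pi)} \prod_{1\le i\le j\le n} x_{i,j}^{\#\{(a,b)\,:\, \pi_a<\pi_b,\ \pi_a=i,\ \pi_b>j\}} \cdot \prod_{1\le j\le i\le n} y_{i,j}^{\#\{(a,b,c)\,:\, \pi_b<\pi_a<\pi_c,\ \pi_a=i,\ \pi_b\ge j\}},$$ where always $1\le a<b<c\le n$ (respectively $1\le a<b\le n$ for pairs). Let $$P_n(t,q;X_n,Y_n):=\sum_{\pi\in\mathcal{S}_n}q^{\mathrm{inv}(\pi)}\,\mathrm{weight}(\pi),$$ with $X_n=[x_{i,j}]$, $Y_n=[y_{i,j}]$; for $n\times n$ matrices $A,B$, $P_n(t,q;A,B)$ denotes the result of substituting $x_{i,j}=A_{i,j}$ for $i\le j$ and $y_{i,j}=B_{i,j}$ for $j\le i$ (entries of $A$ below the diagonal and of $B$ above the diagonal are disregarded). By convention $P_0=1$. A power of $t$ means $t^m$ with $m\ge 0$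 an integer. If $C$ is an $n\times n$ matrix whose entries are powers of $t$ (entries below the diagonal being disregarded) and $D$ is the $n\times n$ matrix all of whose rows equal $[d_1,\ldots,d_n]$ with each $d_j$ a power of $t$, then $$Q_n(t,q;\,C;\,d_1,\ldots,d_n):=P_n(t,q;\,C,D).$$ Operator $R_2$: for $n\times n$ matrices $C=[c_{k,l}]$, $D=[d_{k,l}]$ and $1<i\le n$, $R_2(C,D,i)$ is the $(n-1)\times(n-1)$ matrix obtained from $C$ by deleting the $i$-th row and replacing the $(i-1)$-th and $i$-th columns by a single column, whose entry in the row coming from row $k$ ($k\ne i$) is $$w_k:=\begin{cases} d_{i,1}d_{i,2}\cdots d_{i,k}\cdot c_{k,i-1}\cdot c_{k,i} & k\le i-1,\\ 0 & k>i-1\end{cases}$$ (here $d_{i,j}=d_j$ for the matrix $D$ with identical rows). If $i=1$, $R_2(C,D,1)$ is obtained from $C$ by deleting the first row and first column. *)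

(* Defs.v *)
From mathcomp Require Import all_boot all_order all_algebra all_fingroup.
From mathcomp Require Import mpoly.

Set Implicit Arguments.
Unset Strict Implicit.
Unset Printing Implicit Defensive.

Import GRing.Theory.
Local Open Scope ring_scope.

(* Positions and values are 0-based: the index i of [1, n] is the element i - 1
   of 'I_n. All conditions on permutations below are invariant under this
   shift. *)

Notation Ztq := {mpoly int[2]}.

Definition t : Ztq := 'X_ord0.
Definition q : Ztq := 'X_ord_max.

Definition t_power (c : Ztq) : Prop := exists m : nat, c = t ^+ m.

Definition ninv (n : nat) (pi : 'S_n) : nat :=
  #|[set u : 'I_n * 'I_n | let: (a, b) := u in
      (a < b)%N && (pi b < pi a)%N]|.

Definition N1324 (n : nat) (pi : 'S_n) : nat :=
  #|[set u : 'I_n * 'I_n * 'I_n * 'I_n | let: (a, b, c, d) := u in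
      (a < b < c)%N && (c < d)%N &&
      ((pi a < pi c < pi b)%N && (pi b < pi d)%N)]|.

Definition xexp (n : nat) (pi : 'S_n) (i j : 'I_n) : nat :=
  #|[set u : 'I_n * 'I_n | let: (a, b) := u in
      (a < b)%N && [&& (pi a < pi b)%N, pi a == i & (j < pi b)%N]]|.

Definition yexp (n : nat) (pi : 'S_n) (i j : 'I_n) : nat :=
  #|[set u : 'I_n * 'I_n * 'I_n | let: (a, b, c) := u in
      (a < b < c)%N &&
      [&& (pi b < pi a < pi c)%N, pi a == i & (j <= pi b)%N]]|.

(* Z[t, q][X_n, Y_n]. The variables of the off-range half of each matrix exist
   in this ring but occur in none of the polynomials below. *)
Notation ZtqXY n := {mpoly Ztq[n * n + n * n]}.

Definition xvar (n : nat) (i j : 'I_n) : ZtqXY n :=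
  'X_(lshift (n * n) (mxvec_index i j)).
Definition yvar (n : nat) (i j : 'I_n) : ZtqXY n :=
  'X_(rshift (n * n) (mxvec_index i j)).

Definition weight (n : nat) (pi : 'S_n) : ZtqXY n :=
  (t ^+ N1324 pi)%:MP
  * (\prod_(i < n) \prod_(j < n | (i <= j)%N) xvar i j ^+ xexp pi i j)
  * (\prod_(i < n) \prod_(j < n | (j <= i)%N) yvar i j ^+ yexp pi i j).

Definition P (n : nat) : ZtqXY n :=
  \sum_(pi : 'S_n) (q ^+ ninv pi)%:MP * weight pi.

(* P_n(t, q; A, B), the result of substituting x_{i,j} = A_{i,j} and
   y_{i,j} = B_{i,j} in P_n. *)
Definition Psubst (n : nat) (A B : 'M[Ztq]_n) : Ztq :=
  (P n).@[fun k => row_mx (mxvec A) (mxvec B) ord0 k].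

Definition const_rows (n : nat) (d : 'rV[Ztq]_n) : 'M[Ztq]_n :=
  \matrix_(i, j) d ord0 j.

Definition Q (n : nat) (C : 'M[Ztq]_n) (d : 'rV[Ztq]_n) : Ztq :=
  Psubst C (const_rows d).

(* For l : 'I_n, the column l of the result comes from the column lift i l of C,
   except that column i - 1, for which lift i l = i - 1, carries the merge of
   columns i - 1 and i. Likewise the row k comes from the row lift i k of C. *)
Definition R2 (n : nat) (C D : 'M[Ztq]_n.+1) (i : 'I_n.+1) : 'M[Ztq]_n :=
  if i == ord0 then row' ord0 (col' ord0 C)
  else \matrix_(k, l)
    let k' := lift i k in
    let l' := lift i l in
    if l.+1 == i then
      if (k' < i)%N then (\prod_(j < n.+1 | (j <= k')%N) D i j) * C k' l' * C k' i
      else 0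
    else C k' l'.

(* The list d_1, ..., d_{i-1}, t d_i d_{i+1}, d_{i+2}, ..., d_{n+1}; for j = i,
   lift i j = i + 1. When i is the last index no j : 'I_n equals i, and the list
   is d_1, ..., d_n. *)
Definition merge_d (n : nat) (d : 'rV[Ztq]_n.+1) (i : 'I_n.+1) : 'rV[Ztq]_n :=
  \row_(j < n) if j == i :> nat then t * d ord0 i * d ord0 (lift i j)
               else d ord0 (lift i j).

(* Main.v *)
Require Import Defs.
From mathcomp Require Import all_boot all_order all_algebra all_fingroup.
From mathcomp Require Import mpoly ring.

Set Implicit Arguments.
Unset Strict Implicit.
Unset Printing Implicit Defensive.

Import GRing.Theory.
Local Open Scope ring_scope.

(** A permutation pi of n + 1 values is given by its first value i and by the
    permutation s that standardizes the rest: pi = lift_perm ord0 i s. Every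
    statistic in the weight counts patterns. An occurrence of a pattern in pi
    either avoids the first position, and is then an occurrence in s with its
    values shifted by lift i, or starts there, and then leaves an occurrence of
    a shorter pattern in s:
    - an inversion or a non-inversion that starts with i leaves one value of s;
      these yield q ^ i and the powers of the entries in row i of C
      (first_inversions, first_row_prod);
    - a 213 pattern that starts with i leaves a 12 pattern of s with values on
      both sides of i, and contributes d_0 ... d_k for k its smaller value;
    - a 1324 pattern that starts with i leaves a 213 pattern of s whose values
      all exceed i, and contributes t.
    Hence, once every statistic is turned into a product over the patterns of
    the permutation of factors that depend on values only (Q_prod), the first
    value merely changes the factor of each 12 pattern and of each 213 pattern
    of s (prod12_lift, prod213_lift, prod1324_lift).

    The changed factors are those of the matrix R2 and of the list merge_d. A 12
    pattern with values k < v carries the entries of row k of C in the columns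
    k, ..., v - 1. Since no value of s is shifted to i, a row other than row i
    uses the columns i - 1 and i together, or uses neither; it uses both exactly
    when k < i < v, and this is also when a 213 pattern that starts with i
    contributes d_0 ... d_k. So one merged column accounts for everything
    (row_segment_lift). A 213 pattern with least value v carries d_0 ... d_v.
    This product contains d_i exactly when v > i, and then the pattern also
    extends to a 1324 pattern that starts with i; both are absorbed into the
    entry t d_i d_(i+1) (prefix_prod_lift). *)

(** * Products over the patterns of a permutation *)

Definition prod12 (R : comNzRingType) n (s : 'S_n) (X : 'I_n -> 'I_n -> R) :=
  \prod_(a < n) \prod_(b < n | (a < b)%N) X (s a) (s b).

(** The factor depends on the 1 of the pattern only. The exponent of y_(k,j)
    also records its 2, which is k, but a substitution matrix with identical
    rows does not distinguish between the possible k. *)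
Definition prod213 (R : comNzRingType) n (s : 'S_n) (F : 'I_n -> R) :=
  \prod_(a < n) \prod_(b < n | (a < b)%N) \prod_(c < n | (b < c)%N)
    (if (s b < s a < s c)%N then F (s b) else 1).

Definition prod1324 (R : comNzRingType) n (s : 'S_n) (x : R) :=
  \prod_(a < n) \prod_(b < n | (a < b)%N) \prod_(c < n | (b < c)%N)
    \prod_(d < n | (c < d)%N)
    (if (s a < s c < s b)%N && (s b < s d)%N then x else 1).

Lemma prod12M (R : comNzRingType) n (s : 'S_n) (X Y : 'I_n -> 'I_n -> R) :
  prod12 s (fun k v => X k v * Y k v) = prod12 s X * prod12 s Y.
Proof.
by rewrite -big_split; apply: eq_bigr => a _ /=; rewrite big_split.
Qed.

Lemma prod213M (R : comNzRingType) n (s : 'S_n) (F G : 'I_n -> R) :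
  prod213 s (fun v => F v * G v) = prod213 s F * prod213 s G.
Proof.
rewrite -big_split; apply: eq_bigr => a _ /=.
rewrite -big_split; apply: eq_bigr => b _ /=.
rewrite -big_split; apply: eq_bigr => c _ /=.
by case: ifP => // _; rewrite mulr1.
Qed.

Lemma eq_prod12 (R : comNzRingType) n (s : 'S_n) (X Y : 'I_n -> 'I_n -> R) :
  (forall k v, X k v = Y k v) -> prod12 s X = prod12 s Y.
Proof. by move=> eqXY; do 2![apply: eq_bigr => ? _]. Qed.

Lemma eq_prod213 (R : comNzRingType) n (s : 'S_n) (F G : 'I_n -> R) :
  F =1 G -> prod213 s F = prod213 s G.
Proof. by move=> eqFG; do 3![apply: eq_bigr => ? _]; rewrite eqFG. Qed.

(** * Removal of the first position *)

Lemma ltn_lift2 n (i : 'I_n.+1) (k v : 'I_n) :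
  (lift i k < lift i v)%N = (k < v)%N.
Proof. by rewrite !ltnNge /= leq_bump2. Qed.

Lemma leq_lift2 n (i : 'I_n.+1) (k v : 'I_n) :
  (lift i k <= lift i v)%N = (k <= v)%N.
Proof. exact: leq_bump2. Qed.

Lemma lift_lt n (i : 'I_n.+1) (k : 'I_n) : (lift i k < i)%N = (k < i)%N.
Proof. by rewrite /= /bump; case: (leqP i k) => // ik; rewrite ltnNge leqW. Qed.

Lemma lt_lift n (i : 'I_n.+1) (v : 'I_n) : (i < lift i v)%N = (i <= v)%N.
Proof. by rewrite /= /bump; case: (leqP i v) => // vi; rewrite ltnNge ltnW. Qed.

Lemma lift_le n (i : 'I_n.+1) (k : 'I_n) : (lift i k <= i)%N = (k < i)%N.
Proof. by rewrite leqNgt lt_lift -ltnNge. Qed.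

Lemma le_lift n (i : 'I_n.+1) (v : 'I_n) : (i <= lift i v)%N = (i <= v)%N.
Proof. by rewrite leqNgt lift_lt -leqNgt. Qed.

Lemma big_ord_gt0 (R : comNzRingType) n (F : 'I_n.+1 -> R) :
  \prod_(b < n.+1 | (@ord0 n < b)%N) F b = \prod_(b < n) F (lift ord0 b).
Proof. by rewrite big_mkcond big_ord_recl /= mul1r. Qed.

Lemma big_ord_gt_lift0 (R : comNzRingType) n (F : 'I_n.+1 -> R) (a : 'I_n) :
  \prod_(b < n.+1 | (lift ord0 a < b)%N) F b
  = \prod_(b < n | (a < b)%N) F (lift ord0 b).
Proof.
rewrite big_mkcond big_ord_recl /= mul1r -big_mkcond /=.
by apply: eq_bigl => b; apply: (ltn_lift2 ord0).
Qed.

Definition lift_permE n (i : 'I_n.+1) (s : 'S_n) :=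
  (lift_perm_id ord0 i s, lift_perm_lift ord0 i s).

(** A pair that starts at the first position is determined by the value at its
    second position, which can be any value other than i. *)
Lemma prod12_lift (R : comNzRingType) n (i : 'I_n.+1) (s : 'S_n)
    (X : 'I_n.+1 -> 'I_n.+1 -> R) :
  prod12 (lift_perm ord0 i s) X
  = (\prod_(v < n) X i (lift i v))
    * prod12 s (fun k v => X (lift i k) (lift i v)).
Proof.
rewrite {1}/prod12 big_ord_recl big_ord_gt0; congr (_ * _).
  rewrite [RHS](reindex_inj (@perm_inj _ s)) /=.
  by apply: eq_bigr => b _; rewrite !lift_permE.
apply: eq_bigr => a _; rewrite big_ord_gt_lift0.
by apply: eq_bigr => b _; rewrite !lift_permE.
Qed.

(** The first value plays the part of the 2; what remains of the pattern is a 12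
    whose values surround i. *)
Lemma prod213_lift (R : comNzRingType) n (i : 'I_n.+1) (s : 'S_n)
    (F : 'I_n.+1 -> R) :
  prod213 (lift_perm ord0 i s) F
  = prod12 s (fun k v => if (lift i k < i < lift i v)%N then F (lift i k) else 1)
    * prod213 s (fun v => F (lift i v)).
Proof.
rewrite {1}/prod213 big_ord_recl big_ord_gt0; congr (_ * _).
  apply: eq_bigr => b _; rewrite big_ord_gt_lift0.
  by apply: eq_bigr => c _; rewrite !lift_permE.
apply: eq_bigr => a _; rewrite big_ord_gt_lift0.
apply: eq_bigr => b _; rewrite big_ord_gt_lift0.
by apply: eq_bigr => c _; rewrite !lift_permE !ltn_lift2.
Qed.

(** The first value plays the part of the 1; what remains of the pattern is a
    213, and its least value exceeds i. *)
Lemma prod1324_lift (R : comNzRingType) n (i : 'I_n.+1) (s : 'S_n) (x : R) :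
  prod1324 (lift_perm ord0 i s) x
  = prod213 s (fun v => if (i < lift i v)%N then x else 1) * prod1324 s x.
Proof.
rewrite {1}/prod1324 big_ord_recl big_ord_gt0; congr (_ * _).
  apply: eq_bigr => b _; rewrite big_ord_gt_lift0.
  apply: eq_bigr => c _; rewrite big_ord_gt_lift0.
  apply: eq_bigr => d _; rewrite !lift_permE !ltn_lift2.
  by case: (i < _)%N; rewrite //= if_same.
apply: eq_bigr => a _; rewrite big_ord_gt_lift0.
apply: eq_bigr => b _; rewrite big_ord_gt_lift0.
apply: eq_bigr => c _; rewrite big_ord_gt_lift0.
by apply: eq_bigr => d _; rewrite !lift_permE !ltn_lift2.
Qed.

(** Injectivity suffices, because (n + 1) n! = (n + 1)!. *)
Lemma lift_perm_bij n :
  bijective (fun u : 'I_n.+1 * 'S_n => lift_perm ord0 u.1 u.2).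
Proof.
apply: inj_card_bij => [[i s] [j r] /= /permP eq_isjr|]; last first.
  by rewrite card_prod card_ord !card_Sn factS.
have eq_ij: i = j by have:= eq_isjr ord0; rewrite !lift_permE.
rewrite -eq_ij in eq_isjr *; congr (_, _).
apply/permP => a; have:= eq_isjr (lift ord0 a).
by rewrite !lift_permE => /lift_inj.
Qed.

(** * The value of Q as a sum of products over patterns *)

Lemma expr_card_pair (R : comNzRingType) (T U : finType) (p : T -> pred U)
    (x : R) :
  x ^+ #|[set u : T * U | p u.1 u.2]| = \prod_a \prod_b (if p a b then x else 1).
Proof.
rewrite -prodr_const big_mkcond /= pair_bigA /=.
by apply: eq_bigr => u _; rewrite inE.
Qed.

(** The factor of a 12 pattern with values k < v: it is counted in the exponent
    of x_(k,l) exactly for l in the range of this product. *)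
Definition row_segment (R : comNzRingType) n (C : 'M[R]_n) (k v : 'I_n) : R :=
  \prod_(l < n | (k <= l < v)%N) C k l.

(** The factor of a 213 pattern with least value k: if m is the value of its 2,
    the pattern is counted in the exponent of y_(m,j) exactly for j in the range
    of this product. *)
Definition prefix_prod (R : comNzRingType) n (d : 'rV[R]_n) (k : 'I_n) : R :=
  \prod_(j < n | (j <= k)%N) d ord0 j.

Lemma expr_ninv (R : comNzRingType) n (s : 'S_n) (x : R) :
  x ^+ ninv s = prod12 s (fun k v => if (v < k)%N then x else 1).
Proof.
transitivity (x ^+ #|[set u : 'I_n * 'I_n | (u.1 < u.2)%N && (s u.2 < s u.1)%N]|).
  by congr (_ ^+ _); apply: eq_card => -[a b]; rewrite !inE.
rewrite (expr_card_pair (fun a b : 'I_n => (a < b)%N && (s b < s a)%N)).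
apply: eq_bigr => a _; rewrite [RHS]big_mkcond.
by apply: eq_bigr => b _; case: (a < b)%N.
Qed.

Lemma expr_N1324 (R : comNzRingType) n (s : 'S_n) (x : R) :
  x ^+ N1324 s = prod1324 s x.
Proof.
set p := fun a b c d : 'I_n => (a < b < c)%N && (c < d)%N &&
      ((s a < s c < s b)%N && (s b < s d)%N).
transitivity (x ^+ #|[set u : 'I_n * 'I_n * 'I_n * 'I_n |
                      p u.1.1.1 u.1.1.2 u.1.2 u.2]|).
  by congr (_ ^+ _); apply: eq_card => -[[[a b] c] d]; rewrite !inE.
rewrite (expr_card_pair (fun u d => p u.1.1 u.1.2 u.2 d)).
rewrite -(pair_bigA _ (fun u c => \prod_d if p u.1 u.2 c d then x else 1)) /=.
rewrite -(pair_bigA _ (fun a b => \prod_c \prod_d if p a b c d then x else 1)) /=.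
rewrite /p; apply: eq_bigr => a _.
rewrite [RHS]big_mkcond; apply: eq_bigr => b _; case: ifP => ab; last first.
  by rewrite big1 // => c _; rewrite big1.
rewrite [RHS]big_mkcond; apply: eq_bigr => c _; case: ifP => bc; last first.
  by rewrite big1.
by rewrite [RHS]big_mkcond; apply: eq_bigr => d _; case: (c < d)%N.
Qed.

(** At a row index of the form s a, the condition s a' = s a in xexp determines
    the position a' = a and leaves a product over b alone. *)
Lemma expr_xexp (R : comNzRingType) n (s : 'S_n) (a l : 'I_n) (x : R) :
  x ^+ xexp s (s a) l
  = \prod_(b < n | (a < b)%N) (if (s a < s b)%N && (l < s b)%N then x else 1).
Proof.
set p := fun a' b : 'I_n =>
  (a' < b)%N && [&& (s a' < s b)%N, s a' == s a & (l < s b)%N].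
transitivity (x ^+ #|[set u : 'I_n * 'I_n | p u.1 u.2]|).
  by congr (_ ^+ _); apply: eq_card => -[a' b]; rewrite !inE.
rewrite (expr_card_pair p) (bigD1 a) //= [X in _ * X]big1 ?mulr1; last first.
  move=> a' ne_a'a; rewrite big1 // => b _; rewrite /p (inj_eq perm_inj).
  by rewrite (negPf ne_a'a) !andbF.
rewrite [RHS]big_mkcond; apply: eq_bigr => b _.
by rewrite /p eqxx; case: (a < b)%N.
Qed.

Lemma expr_yexp (R : comNzRingType) n (s : 'S_n) (a j : 'I_n) (x : R) :
  x ^+ yexp s (s a) j
  = \prod_(b < n | (a < b)%N) \prod_(c < n | (b < c)%N)
      (if (s b < s a < s c)%N && (j <= s b)%N then x else 1).
Proof.
set p := fun a' b c : 'I_n =>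
  (a' < b < c)%N && [&& (s b < s a' < s c)%N, s a' == s a & (j <= s b)%N].
transitivity (x ^+ #|[set u : 'I_n * 'I_n * 'I_n | p u.1.1 u.1.2 u.2]|).
  by congr (_ ^+ _); apply: eq_card => -[[a' b] c]; rewrite !inE.
rewrite (expr_card_pair (fun u c => p u.1 u.2 c)).
rewrite -(pair_bigA _ (fun a' b => \prod_c if p a' b c then x else 1)) /=.
rewrite (bigD1 a) //= [X in _ * X]big1 ?mulr1; last first.
  move=> a' ne_a'a; rewrite big1 // => b _; rewrite big1 // => c _.
  by rewrite /p (inj_eq perm_inj) (negPf ne_a'a) !andbF.
rewrite [RHS]big_mkcond; apply: eq_bigr => b _; rewrite /p eqxx /=.
case: (a < b)%N => /=; last by rewrite big1.
by rewrite [RHS]big_mkcond; apply: eq_bigr => c _; case: (b < c)%N.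
Qed.

(** Rows are reindexed by positions, and then the product over the columns is
    exchanged with the product over the pairs that each column counts. *)
Lemma prod_xexp (R : comNzRingType) n (s : 'S_n) (C : 'M[R]_n) :
  \prod_(k < n) \prod_(l < n | (k <= l)%N) C k l ^+ xexp s k l
  = prod12 s (row_segment C).
Proof.
rewrite (reindex_inj (@perm_inj _ s)); apply: eq_bigr => a _ /=.
under eq_bigr do rewrite expr_xexp.
rewrite exchange_big; apply: eq_bigr => b _ /=.
rewrite /row_segment big_mkcond [RHS]big_mkcond; apply: eq_bigr => l _.
case: (leqP (s a) l) => /= al; last by [].
case: (ltnP l (s b)) => [lb|_]; last by rewrite andbF.
by rewrite (leq_ltn_trans al lb).
Qed.

Lemma prod_yexp (R : comNzRingType) n (s : 'S_n) (d : 'rV[R]_n) :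
  \prod_(k < n) \prod_(j < n | (j <= k)%N) d ord0 j ^+ yexp s k j
  = prod213 s (prefix_prod d).
Proof.
rewrite (reindex_inj (@perm_inj _ s)); apply: eq_bigr => a _ /=.
under eq_bigr do rewrite expr_yexp.
rewrite exchange_big; apply: eq_bigr => b _ /=.
rewrite exchange_big; apply: eq_bigr => c _ /=.
case: ifP => [/andP[ba ac]|_]; last by rewrite big1.
rewrite /prefix_prod big_mkcond [RHS]big_mkcond; apply: eq_bigr => j _ /=.
case: (leqP j (s b)) => [jb|_]; last by rewrite if_same.
by rewrite (leq_trans jb (ltnW ba)).
Qed.

Lemma Q_prod n (C : 'M[Ztq]_n) (d : 'rV[Ztq]_n) :
  Q C d = \sum_(s : 'S_n)
    q ^+ ninv s * t ^+ N1324 s * prod12 s (row_segment C)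
    * prod213 s (prefix_prod d).
Proof.
rewrite /Q /Psubst /P raddf_sum; apply: eq_bigr => s _ /=.
rewrite /weight !rmorphM /= !mevalC !mulrA -prod_xexp -prod_yexp.
rewrite !rmorph_prod; congr (_ * _ * _); apply: eq_bigr => k _;
  rewrite rmorph_prod; apply: eq_bigr => l _; rewrite rmorphXn /= mevalXU.
  by rewrite row_mxEl mxvecE.
by rewrite row_mxEr mxvecE mxE.
Qed.

(** * The effect of the first value on the factors *)

Lemma prod_if_eq (R : comNzRingType) n (p : pred nat) (m : nat) (x : R) :
  \prod_(j < n | p j) (if j == m :> nat then x else 1)
  = if (m < n)%N && p m then x else 1.
Proof.
rewrite -big_mkcondr /=; case: (ltnP m n) => [mn|nm] /=; last first.
  rewrite big_pred0 // => j; case: eqP => [jm|_]; last by rewrite andbF.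
  by have:= ltn_ord j; rewrite jm ltnNge nm.
case pm: (p m).
  rewrite (big_pred1 (Ordinal mn)) // => j; rewrite /= -val_eqE /=.
  by case: eqP => [->|_]; rewrite ?pm ?andbF.
by rewrite big_pred0 // => j; case: eqP => [->|_]; rewrite ?pm ?andbF.
Qed.

(** Indices of 'I_n.+1 are i itself and the lift i j, and all the quantities
    compared below differ only in what happens at i. *)
Lemma big_ord_lift (R : comNzRingType) n (i : 'I_n.+1) (p : pred 'I_n.+1)
    (F : 'I_n.+1 -> R) :
  \prod_(j < n.+1 | p j) F j
  = (if p i then F i else 1) * \prod_(j < n | p (lift i j)) F (lift i j).
Proof. by rewrite big_mkcond (bigD1_ord i) //= -big_mkcond. Qed.

(** Both d_i and the factor t of a 1324 pattern that starts with i are there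
    exactly when the shifted v exceeds i, which is when the entry i of merge_d
    is among the factors on the right. *)
Lemma prefix_prod_lift n (d : 'rV[Ztq]_n.+1) (i : 'I_n.+1) (v : 'I_n) :
  (if (i < lift i v)%N then t else 1) * prefix_prod d (lift i v)
  = prefix_prod (merge_d d i) v.
Proof.
have mergeE (j : 'I_n) : merge_d d i ord0 j
    = d ord0 (lift i j) * (if j == i :> nat then t * d ord0 i else 1).
  by rewrite mxE; case: eqP; rewrite ?mulr1 // mulrC.
rewrite [RHS](eq_bigr _ (fun j _ => mergeE j)) big_split /=.
rewrite (prod_if_eq n (fun j => (j <= v)%N)).
rewrite /prefix_prod (big_ord_lift i) lt_lift le_lift.
under [X in _ * (_ * X)]eq_bigl do rewrite leq_lift2.
case: (leqP i v) => [iv|_]; last by rewrite andbF !mul1r mulr1.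
by rewrite (leq_ltn_trans iv (ltn_ord v)) mulrA mulrC.
Qed.

(** The shifted range contains i exactly when it contains i - 1, which is also
    the condition on the 213 patterns that start with i. So the entry in column
    i and the product of the d_j can be charged to the column i - 1, as R2 does.
    For i = 0 none of this happens: no value is less than i, and R2 merges
    nothing. *)
Lemma row_segment_lift n (C : 'M[Ztq]_n.+1) (d : 'rV[Ztq]_n.+1)
    (i : 'I_n.+1) (k v : 'I_n) :
  row_segment C (lift i k) (lift i v)
    * (if (lift i k < i < lift i v)%N then prefix_prod d (lift i k) else 1)
  = row_segment (R2 C (const_rows d) i) k v.
Proof.
(* What R2 adds to the column i - 1; the test on 0 < i is needed because
   i.-1 = 0 also when i = 0. *)
set x := C (lift i k) i * prefix_prod d (lift i k).
have R2E (l : 'I_n) : (k <= l < v)%N -> R2 C (const_rows d) i k l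
    = C (lift i k) (lift i l)
      * (if l == i.-1 :> nat then if (0 < i)%N then x else 1 else 1).
  case/andP=> kl _; rewrite /R2 -val_eqE /=; case: posnP => [i0|i_gt0].
    have -> : i = ord0 by apply: val_inj.
    by rewrite !mxE if_same mulr1.
  have -> : (l == i.-1 :> nat) = (l.+1 == i) by rewrite -eqSS prednK.
  rewrite !mxE.
  case: eqP => [li|_]; last by rewrite mulr1.
  have ki : (k < i)%N by rewrite -li ltnS.
  rewrite lift_lt ki /x mulrA [RHS]mulrC mulrA; congr (_ * _ * _).
  by apply: eq_bigr => j _; rewrite mxE.
rewrite [RHS](eq_bigr _ R2E) big_split /=.
rewrite (prod_if_eq n (fun l => (k <= l < v)%N)).
rewrite /row_segment (big_ord_lift i) lift_le !lt_lift lift_lt.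
under [X in _ * X * _]eq_bigl do rewrite leq_lift2 ltn_lift2.
rewrite mulrAC mulrC; congr (_ * _).
case: posnP => [->|i_gt0]; first by rewrite !if_same mulr1.
rewrite -(ltnS k) prednK //.
case: ifP => [/andP[_ iv]|_]; last by rewrite andbF mulr1.
by rewrite (leq_trans iv (ltnW (ltn_ord v))).
Qed.

(** Column j counts the values above both i and j, and n - j values exceed j
    when i <= j. *)
Lemma first_row_prod (R : comNzRingType) n (C : 'M[R]_n.+1) (i : 'I_n.+1) :
  \prod_(v < n) row_segment C i (lift i v)
  = \prod_(j < n.+1 | (i <= j < n)%N) C i j ^+ (n - j).
Proof.
rewrite (exchange_big_dep (fun j : 'I_n.+1 => (i <= j < n)%N)) /=; last first.
  move=> v j _ /andP[ij jv]; rewrite ij /=; apply: leq_trans jv _.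
  by rewrite -ltnS; apply: (ltn_ord (lift i v)).
apply: eq_bigr => j /andP[ij jn].
rewrite -prodr_const_nat big_geq_mkord; apply: eq_bigl => v.
rewrite ij /= /bump; case: (leqP i v) => [iv|vi]; first by rewrite ltnS.
have vj : (v < j)%N := leq_trans vi ij.
by rewrite add0n (leqNgt j v) (ltnNge j v) vj ltnW.
Qed.

Lemma first_inversions (R : comNzRingType) n (i : 'I_n.+1) (x : R) :
  \prod_(v < n) (if (lift i v < i)%N then x else 1) = x ^+ i.
Proof.
have lin : (i <= n)%N by rewrite -ltnS.
rewrite -big_mkcond -[in RHS](card_ord i) -prodr_const.
rewrite (big_ord_widen n (fun=> x) lin); apply: eq_bigl => v; exact: lift_lt.
Qed.

Theorem corollary2 (n : nat) (C : 'M[Ztq]_n.+1) (d : 'rV[Ztq]_n.+1)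
    (hC : forall k l : 'I_n.+1, (k <= l)%N -> t_power (C k l))
    (hd : forall j : 'I_n.+1, t_power (d ord0 j)) :
  Q C d =
  \sum_(i < n.+1)
    q ^+ i * (\prod_(j < n.+1 | (i <= j < n)%N) C i j ^+ (n - j))
    * Q (R2 C (const_rows d) i) (merge_d d i).
Proof.
rewrite Q_prod (reindex _ (onW_bij _ (lift_perm_bij n))) /=.
rewrite -(pair_bigA _ (fun i s => let r := lift_perm ord0 i s in
  q ^+ ninv r * t ^+ N1324 r * prod12 r (row_segment C)
  * prod213 r (prefix_prod d))) /=.
apply: eq_bigr => i _; rewrite Q_prod mulr_sumr; apply: eq_bigr => s _.
rewrite !expr_ninv !expr_N1324 !prod12_lift prod213_lift prod1324_lift.
rewrite first_inversions first_row_prod.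
rewrite -(eq_prod12 s (row_segment_lift C d i)) prod12M.
rewrite -(eq_prod213 s (prefix_prod_lift d i)) prod213M.
have -> : prod12 s (fun k v => if (lift i v < lift i k)%N then q else 1)
          = prod12 s (fun k v => if (v < k)%N then q else 1).
  by apply: eq_prod12 => k v; rewrite ltn_lift2.
(* Over an abstract ring, so that no conversion enters the polynomial ring. *)
have shuffle (R : comNzRingType) (a b x1 x2 x3 y1 y2 z : R) :
    a * x1 * (y1 * z) * (b * x2) * (x3 * y2)
    = a * b * (x1 * z * (x2 * x3) * (y1 * y2)) by ring.
exact: shuffle.
Qed.
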